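(* Let $n,m$ be positive integers, let $A=(a_{ij})\in\mathbb{R}^{n\times m}_{>0}$ be a matrix with strictly positive entries, and let $\mathbf{R}=(R_1,\dots,R_n)^\top\in\mathbb{R}^n_{>0}$ and $\mathbf{C}=(C_1,\dots,C_m)^\top\in\mathbb{R}^m_{>0}$ be target row and column sums with $\sum_{i=1}^n R_i=\sum_{j=1}^m C_j$. Let $S=(s_{ij})=\operatorname{Sink}(A\mid\mathbf{R},\mathbf{C})=D_1AD_2$ be the generalized Sinkhorn limit of $A$, where $D_1=\operatorname{diag}(r_1,\dots,r_n)$ and $D_2=\operatorname{diag}(c_1,\dots,c_m)$ are positive diagonal matrices such that $S\mathbf{1}_m=\mathbf{R}$ and $S^\top\mathbf{1}_n=\mathbf{C}$. Then every entry $s_{ij}$ of $S$ is algebraic over the field $\mathbb{Q}(A,\mathbf{R},\mathbf{C})$ with degree at most $\binom{n+m-2}{n-1}$.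
   Context: Generalized Sinkhorn limit: let $A\in\mathbb{R}^{n\times m}_{>0}$ be a matrix with strictly positive entries, and let $\mathbf{R}\in\mathbb{R}^n_{>0}$, $\mathbf{C}\in\mathbb{R}^m_{>0}$ satisfy the consistency condition $\sum_i R_i=\sum_j C_j$. The generalized Sinkhorn limit $\operatorname{Sink}(A\mid\mathbf{R},\mathbf{C})$ is the matrix $S=D_1AD_2$, where $D_1=\operatorname{diag}(r_1,\dots,r_n)$ and $D_2=\operatorname{diag}(c_1,\dots,c_m)$ are diagonal matrices with strictly positive diagonal entries such that $S\mathbf{1}_m=\mathbf{R}$ and $S^\top\mathbf{1}_n=\mathbf{C}$; here $\mathbf{1}_k$ is the column vector of $k$ ones. It is a known theorem of Sinkhorn that such $D_1,D_2$ exist and are unique up to $D_1\mapsto\lambda D_1$, $D_2\mapsto\lambda^{-1}D_2$ with $\lambda>0$, so that $S$ exists and is unique. $\mathbb{Q}(A,\mathbf{R},\mathbf{C})$ denotes the subfield of $\mathbb{R}$ generated over $\mathbb{Q}$ by all the numbers $a_{ij}$, $R_i$, $C_j$. *)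

(* Defs.v *)
From mathcomp Require Import all_boot all_order all_algebra.
From mathcomp Require Import boolp classical_sets reals.

Set Implicit Arguments.
Unset Strict Implicit.
Unset Printing Implicit Defensive.

Import Order.TTheory GRing.Theory Num.Theory.
Local Open Scope classical_set_scope.
Local Open Scope ring_scope.

(* S = Sink(A | Rv, Cv). For positive A, Rv, Cv with equal total sums, exactly
   one S satisfies this: by Sinkhorn's theorem, r and c exist and are unique up
   to (r, c) |-> (l r, l^-1 c) with l > 0. *)
Definition is_sinkhorn_limit (R : realType) (n m : nat) (A : 'M[R]_(n, m))
    (Rv : 'cV[R]_n) (Cv : 'cV[R]_m) (S : 'M[R]_(n, m)) : Prop :=
  exists (r : 'rV[R]_n) (c : 'rV[R]_m),
    [/\ (forall i, 0 < r 0 i) /\ (forall j, 0 < c 0 j),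
        S = diag_mx r *m A *m diag_mx c,
        S *m const_mx 1 = Rv
      & S^T *m const_mx 1 = Cv].

(* Since x / 0 = 0, the divring_closed predicates on a field are exactly its
   subfields. In characteristic 0 each of them contains the rationals, so this
   is also the subfield generated by X over Q. *)
Definition gen_subfield (F : fieldType) (X : set F) : {pred F} :=
  fun x => `[< forall K : {pred F}, divring_closed K ->
                 (forall y, X y -> y \in K) -> x \in K >].

Lemma gen_subfield_closed (F : fieldType) (X : set F) :
  divring_closed (gen_subfield X).
Proof.
split.
- by apply/asboolP => K [].
- move=> x y /asboolP hx /asboolP hy; apply/asboolP => K hK XK.
  by have [_ hB _] := hK; apply: hB; [apply: hx | apply: hy].
- move=> x y /asboolP hx /asboolP hy; apply/asboolP => K hK XK.
  by have [_ _ hD] := hK; apply: hD; [apply: hx | apply: hy].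
Qed.

Lemma sub_gen_subfield (F : fieldType) (X : set F) (x : F) :
  X x -> x \in gen_subfield X.
Proof. by move=> Xx; apply/asboolP => K _; apply. Qed.

Definition entries_field (R : realType) (n m : nat) (A : 'M[R]_(n, m))
    (Rv : 'cV[R]_n) (Cv : 'cV[R]_m) : {pred R} :=
  gen_subfield (range (fun ij : 'I_n * 'I_m => A ij.1 ij.2)
                `|` range (fun i => Rv i 0) `|` range (fun j => Cv j 0)).

Definition is_min_poly (F : fieldType) (K : {pred F}) (x : F) (p : {poly F}) :
    Prop :=
  [/\ p \is monic, p \is a polyOver K, root p x
    & forall q : {poly F}, q \is a polyOver K -> q != 0 -> root q x ->
        (size p <= size q)%N].

(* size p is the degree of p plus one. *)
Definition algebraic_of_degree (F : fieldType) (K : {pred F}) (x : F)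
    (d : nat) : Prop :=
  exists2 p : {poly F}, is_min_poly K x p & size p = d.+1.

(* Main.v *)
Require Import Defs.
From HB Require Import structures.
From mathcomp Require Import all_boot all_order all_algebra.
From mathcomp Require Import ring.
From mathcomp Require Import boolp classical_sets reals.

Import Order.TTheory GRing.Theory Num.Theory.
Local Open Scope ring_scope.

(** The Sinkhorn limit S = (a_ij r_i c_j) is a point of a Segre variety cut out
    by linear equations: with tau the common total of the row and column sums,
    and sigma the sum of all entries, S satisfies
    tau * (sum of row i) = R_i * sigma and tau * (sum of column j) = C_j * sigma.
    One row equation and one column equation follow from the others, which
    leaves n + m - 2 equations, bilinear in (r, c) with coefficients in the
    field K generated by the data. The Segre variety P^(n-1) x P^(m-1) has
    dimension n + m - 2 and degree 'C(n + m - 2, n - 1), so this is the degree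
    expected for an isolated solution; [isolated_point_degree] proves the bound
    for any nondegenerate solution of such a system, and the rest of the proof
    checks nondegeneracy for the Sinkhorn equations.

    The degree bound comes from an explicit resultant. Adjoin to the equations
    the bilinear form tau * s_ij - lambda * sigma, which vanishes at the solution
    when lambda = s_ij. Multiplying each of these n + m - 1 forms by all
    monomials of degree m - 1 in r gives forms that are linear combinations of
    the r^alpha * c_j with |alpha| = m; let M be the matrix of coefficients
    ([sylvester]). At a solution the vector of values r^alpha * c_j is in the
    kernel of M ([sylvester_monomials]), so all maximal minors of M vanish.
    Only the rows built from the last form contain lambda, and there are as
    many of them as monomials of degree m - 1 in n variables, namely
    'C(n + m - 2, n - 1): a maximal minor is a polynomial over K of at most this
    degree in lambda, with s_ij as a root.

    The minor may however vanish identically, when the equations have a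
    positive-dimensional set of other solutions. So the forms are deformed:
    the k-th one moves along a line, with parameter t, towards the form
    r(x_k) * c(x_k), where r and c are read as the polynomials with
    coefficients r_i and c_j, and the x_k are distinct numbers of K. For these
    special forms M has full column rank ([sylvester_full]), so some minor D is
    a nonzero polynomial in t and lambda. Since the solution is nondegenerate,
    it extends to a solution modulo any power of t ([lift_solution]), along
    which D vanishes to that order; hence the coefficient of the lowest power
    of t occurring in D, a nonzero polynomial in lambda, still vanishes at s_ij
    ([lowest_coef_root]).

    Nondegeneracy: the increment of the logarithms (x, y) of (r, c) changes s_ij
    by s_ij (x_i + y_j), and the energy sum_ij s_ij (x_i + y_j)^2 vanishes only
    when all x_i + y_j do, so every change of the row and column sums that
    preserves the equality of totals is realized ([sum_laplacian_surj]). *)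

(** * Monomials of a given degree *)

(** A monomial of degree d in n variables, as the sorted list of its factors. *)
Definition mono (n d : nat) : predArgType :=
  {t : d.-tuple 'I_n | sorted leq [seq val i | i <- t]}.

HB.instance Definition _ n d := Finite.on (mono n d).

Coercion mono_seq n d (a : mono n d) : seq 'I_n := tval (val a).

Arguments mono_seq {n d} a.

Lemma card_mono n d : #|mono n.+1 d| = 'C(d + n, d).
Proof.
by rewrite -card_sorted_tuples cardsE card_sig.
Qed.

Lemma sorted_mono_unique n d (s : seq 'I_n) : size s = d ->
  exists a : mono n d, forall b : mono n d, perm_eq s b = (b == a).
Proof.
move=> sz_s; pose le := relpre (val : 'I_n -> nat) leq.
have le_tr : transitive le by move=> y x z; apply: leq_trans.
have le_tot : total le by move=> x y; apply: leq_total.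
have le_anti : antisymmetric le by move=> x y xy; apply/val_inj/anti_leq.
have sz_t : size (sort le s) == d by rewrite size_sort sz_s.
have st : sorted leq [seq val i | i <- Tuple sz_t].
  by rewrite sorted_map; apply: sort_sorted.
exists (exist _ (Tuple sz_t) st) => b; apply/idP/eqP => [sb|->] /=; last first.
  by rewrite /mono_seq /= perm_sym perm_sort.
apply/val_inj/val_inj/(sorted_eq le_tr le_anti) => /=.
- by move: (valP b); rewrite sorted_map.
- exact: sort_sorted.
- by rewrite -[X in perm_eq X _]/(mono_seq b) perm_sym perm_sort.
Qed.

(** * Linear forms in general position *)

Section GeneralPosition.
Variables (F : fieldType) (I : finType) (n m : nat) (x : I -> F).
Hypothesis x_inj : injective x.

(** The f i are the coefficients of a polynomial of degree less than p with
    at least p distinct roots. *)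
Lemma vanish_at_distinct p (f : 'I_p -> F) (s : seq I) :
  uniq s -> (p <= size s)%N ->
  {in s, forall k, \sum_(i < p) x k ^+ i * f i = 0} -> forall i, f i = 0.
Proof.
move=> Us le_ps fs0 i.
pose g := \poly_(j < p) oapp f 0 (insub j).
have g0 : g = 0.
  apply/eqP; apply/negPn/negP => nz.
  have: (size (map x s) < size g)%N.
    apply: max_poly_roots nz _ _; last by rewrite map_inj_uniq.
    apply/allP => _ /mapP[k ks ->]; apply/rootP.
    rewrite horner_poly -[RHS](fs0 k ks); apply: eq_bigr => j _.
    by rewrite valK /= mulrC.
  by rewrite size_map ltnNge (leq_trans (size_poly _ _)).
have := congr1 (fun q : {poly F} => q`_i) g0.
by rewrite coef_poly ltn_ord valK coef0.
Qed.

(* phi is a linear form on the span of the monomials t of degree d.+1 times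
   the c_j, extended to unsorted t; [contract J] evaluates it on t * c_j times
   the product over k in J of the linear forms r(x_k). *)
Variable phi : seq 'I_n -> 'I_m -> F.
Hypothesis phi_perm : forall s t j, perm_eq s t -> phi s j = phi t j.

Fixpoint contract (J : seq I) (t : seq 'I_n) (j : 'I_m) : F :=
  if J is k :: J' then \sum_(i < n) x k ^+ i * contract J' (i :: t) j else phi t j.

Lemma contract_perm J s t j : perm_eq s t -> contract J s j = contract J t j.
Proof.
elim: J s t => [|k J IHJ] s t st /=; first exact: phi_perm.
by apply: eq_bigr => i _; rewrite (IHJ _ (i :: t)) // perm_cons.
Qed.

Variable d : nat.
Hypothesis phi_ker : forall k (t : seq 'I_n), size t = d ->
  \sum_(j < m) x k ^+ j * \sum_(i < n) x k ^+ i * phi (i :: t) j = 0.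

Lemma contract_ker k J t : (size J + size t)%N = d ->
  \sum_(j < m) x k ^+ j * \sum_(i < n) x k ^+ i * contract J (i :: t) j = 0.
Proof.
elim: J t => [|l J IHJ] t /= sz; first exact: phi_ker.
under eq_bigr => j _.
  rewrite mulr_sumr; under eq_bigr => i _ do rewrite mulr_sumr mulr_sumr.
  rewrite exchange_big /=; over.
rewrite exchange_big /= big1 // => i _.
rewrite -[RHS](mulr0 (x l ^+ i)) -[in RHS](IHJ (i :: t)); last first.
  by rewrite /= -sz addnS.
rewrite mulr_sumr; apply: eq_bigr => j _.
rewrite !mulr_sumr; apply: eq_bigr => a _.
rewrite (@contract_perm J [:: i, a & t] [:: a, i & t]); first by ring.
exact/permPl/(perm_catCA [:: i] [:: a]).
Qed.

Lemma contract_mem_ker k J t : k \in J -> (size J + size t)%N = d.+1 ->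
  \sum_(j < m) x k ^+ j * contract J t j = 0.
Proof.
elim: J t => [|l J IHJ] t //=; rewrite in_cons => /predU1P[<- [sz]|kJ [sz]].
  exact: contract_ker.
under eq_bigr => j _ do rewrite mulr_sumr.
rewrite exchange_big /= big1 // => i _.
rewrite -[RHS](mulr0 (x l ^+ i)) -[in RHS](IHJ (i :: t)) //; last first.
  by rewrite /= addnS sz.
by rewrite mulr_sumr; apply: eq_bigr => j _; ring.
Qed.

Hypothesis dm : (m <= d.+1)%N.
Hypothesis cardI : (n + d <= #|I|)%N.

(** The products of d.+1 distinct linear forms, any n of which are independent,
    span the forms of degree d.+1: this is the descending induction on the number
    of linear forms, since those outside J are numerous enough to express any
    variable. A product with all its d.+1 factors kills every c_j because its
    contraction with c(x_k) vanishes for d.+1 values of k. *)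
Lemma contract_eq0 J t j :
  uniq J -> (size J + size t)%N = d.+1 -> contract J t j = 0.
Proof.
elim: t J j => [|i t IHt] J j UJ sz.
  move: sz; rewrite addn0 => sz.
  apply: (@vanish_at_distinct m (contract J [::]) J) => // [|k kJ].
    by rewrite sz.
  by apply: contract_mem_ker; rewrite ?addn0.
pose C := [seq k <- enum I | k \notin J].
apply: (@vanish_at_distinct n (fun i => contract J (i :: t) j) C).
- by rewrite filter_uniq ?enum_uniq.
- have := count_predC [in J] (enum I); rewrite -cardE => eqI.
  have cJ : (count [in J] (enum I) <= size J)%N.
    rewrite -size_filter; apply: uniq_leq_size => [|k].
      by rewrite filter_uniq ?enum_uniq.
    by rewrite mem_filter => /andP[].
  rewrite size_filter -(leq_add2l (size J)).
  apply: (@leq_trans (n + d)%N); last first.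
    by apply: (leq_trans cardI); rewrite -eqI leq_add2r.
  by rewrite addnC leq_add2l -ltnS -sz /= addnS ltnS leq_addr.
- move=> k; rewrite mem_filter => /andP[kJ _].
  by apply: (IHt (k :: J)); rewrite /= ?kJ //= -sz /= addnS.
Qed.

End GeneralPosition.

(** * The Sylvester matrix of a family of bilinear forms *)

Definition bil {S : comNzRingType} {n m : nat} (B : 'I_n -> 'I_m -> S)
    (r : 'I_n -> S) (c : 'I_m -> S) : S :=
  \sum_i \sum_j B i j * r i * c j.

(** Row (b, k) holds the coefficients of the monomial b times the form B k,
    in terms of the monomials a of degree d.+1 times the c_j. *)
Definition sylvester {S : comNzRingType} {n m} (d : nat) {I : finType}
    (B : I -> 'I_n -> 'I_m -> S) :
    'M[S]_(#|{: mono n d * I}|, #|{: mono n d.+1 * 'I_m}|) :=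
  \matrix_(u, v)
    let bk : mono n d * I := enum_val u in
    let aj : mono n d.+1 * 'I_m := enum_val v in
    \sum_(i | perm_eq (i :: mono_seq bk.1) aj.1) B bk.2 i aj.2.

Definition monomials {S : comNzRingType} {n m} (d : nat) (r : 'I_n -> S)
    (c : 'I_m -> S) : 'cV[S]_#|{: mono n d * 'I_m}| :=
  \col_v let aj : mono n d * 'I_m := enum_val v in
    (\prod_(i <- aj.1) r i) * c aj.2.

Lemma sylvester_monomials (S : comNzRingType) (n m d : nat) (I : finType)
    (B : I -> 'I_n -> 'I_m -> S) r c u :
  let bk : mono n d * I := enum_val u in
  (sylvester d B *m monomials d.+1 r c) u 0 =
    \prod_(i <- bk.1) r i * bil (B bk.2) r c.
Proof.
rewrite /= mxE; case bkE: (enum_val u) => [b k] /=.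
pose G (aj : mono n d.+1 * 'I_m) :=
  (\sum_(i | perm_eq (i :: mono_seq b) aj.1) B k i aj.2) *
  (\prod_(i <- aj.1) r i * c aj.2).
transitivity (\sum_aj G aj).
  have -> : \sum_aj G aj = \sum_(v < #|{: mono n d.+1 * 'I_m}|) G (enum_val v).
    by rewrite -big_enum_val.
  by apply: eq_bigr => v _; rewrite !mxE bkE.
rewrite -(pair_bigA _ (fun a j => G (a, j))) exchange_big /= mulr_sumr.
rewrite [in RHS](eq_bigr (fun i => \sum_j \prod_(i <- mono_seq b) r i * (B k i j * r i * c j))).
  rewrite [RHS]exchange_big /=; apply: eq_bigr => j _.
  under eq_bigr => a _ do rewrite /G /= mulr_suml.
  rewrite (exchange_big_dep predT) //=; apply: eq_bigr => i _.
  have [|a ha] := @sorted_mono_unique n d.+1 (i :: mono_seq b); first by rewrite /= size_tuple.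
  rewrite (eq_bigl (pred1 a)) // big_pred1_eq.
  rewrite (perm_big (i :: mono_seq b)) /=; last by rewrite perm_sym ha.
  by rewrite big_cons; ring.
by move=> i _; rewrite mulr_sumr.
Qed.

Lemma map_sylvester (S S' : comNzRingType) (f : {rmorphism S -> S'})
    (n m d : nat) (I : finType) (B : I -> 'I_n -> 'I_m -> S) :
  map_mx f (sylvester d B) =
  sylvester d (fun k i j => f (B k i j)).
Proof. by apply/matrixP => u v; rewrite !mxE rmorph_sum. Qed.

(** The forms r(x_k) * c(x_k) have no common zero when the x_k are distinct:
    one of the polynomials r and c would have too many roots. Already in degree
    d.+1 the ideal which they generate contains all products of a monomial
    and a c_j. *)
Lemma sylvester_full (F : fieldType) (n d : nat) (I : finType) (x : I -> F) :
  injective x -> (n + d <= #|I|)%N ->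
  row_full (sylvester d
              (fun k (i : 'I_n) (j : 'I_d.+1) => x k ^+ i * x k ^+ j)).
Proof.
move=> x_inj cardI; set M := sylvester _ _.
rewrite -col_leq_rank -mxrank_tr row_leq_rank; apply: inj_row_free => v vM0.
pose phi (s : seq 'I_n) (j : 'I_d.+1) :=
  \sum_(a : mono n d.+1 | perm_eq s a) v 0 (enum_rank (a, j)).
have phi_perm s t j : perm_eq s t -> phi s j = phi t j.
  move=> st; apply: eq_bigl => a; exact: (permPl st).
have phi_ker k (t : seq 'I_n) : size t = d ->
    \sum_(j < d.+1) x k ^+ j * \sum_(i < n) x k ^+ i * phi (i :: t) j = 0.
  move=> sz; have [b hb] := sorted_mono_unique _ _ _ sz.
  have tb : perm_eq t (mono_seq b) by rewrite hb.
  have := congr1 (fun N : 'rV_ _ => N 0 (enum_rank (b, k))) vM0.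
  rewrite /= [X in X = _]mxE [X in _ = X]mxE => vb0; apply: etrans vb0.
  pose G (aj : mono n d.+1 * 'I_d.+1) := v 0 (enum_rank aj) *
    (\sum_(i | perm_eq (i :: mono_seq b) aj.1) x k ^+ i * x k ^+ aj.2).
  transitivity (\sum_aj G aj); last first.
    have -> : \sum_aj G aj =
        \sum_(v < #|{: mono n d.+1 * 'I_d.+1}|) G (enum_val v).
      by rewrite -big_enum_val.
    by apply: eq_bigr => w _; rewrite !mxE enum_rankK /G enum_valK.
  have -> : \sum_aj G aj = \sum_a \sum_j G (a, j).
    by rewrite pair_bigA; apply: eq_bigr => -[].
  rewrite [RHS]exchange_big /=.
  apply: eq_bigr => j _.
  under [RHS]eq_bigr => a _ do rewrite /G /= mulr_sumr.
  rewrite (exchange_big_dep predT) //= mulr_sumr; apply: eq_bigr => i _.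
  rewrite (@phi_perm (i :: t) (i :: mono_seq b)) ?perm_cons // !mulr_sumr.
  by apply: eq_bigr => a _; ring.
apply/rowP => w; rewrite mxE; case wE: (enum_val w) => [a j].
have sz_a : size (mono_seq a) = d.+1 by rewrite size_tuple.
have := contract_eq0 F I n d.+1 x x_inj phi phi_perm d phi_ker (leqnn _) cardI
  [::] (mono_seq a) j isT sz_a.
rewrite /= /phi; have [a' ha] := sorted_mono_unique _ _ _ sz_a.
have /eqP aa' : a == a' by rewrite -ha.
by rewrite (eq_bigl (pred1 a')) // big_pred1_eq -aa' -wE enum_valK.
Qed.

Lemma size_det_rows (S : comNzRingType) N (M : 'M[{poly S}]_N) (e : 'I_N -> nat) :
  (forall u v, size (M u v) <= (e u).+1)%N ->
  (size (\det M) <= (\sum_u e u).+1)%N.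
Proof.
move=> szM; apply: (leq_trans (size_sum _ _ _)); apply/bigmax_leqP => s _.
rewrite size_Msign; apply: (leq_trans (size_poly_prod_leq _ _)).
rewrite card_ord leq_subLR addnS ltnS.
have -> : (N + \sum_u e u = \sum_u (e u).+1)%N.
  under [RHS]eq_bigr => u _ do rewrite -add1n.
  rewrite big_split /=.
  by rewrite sum1_card card_ord.
exact: leq_sum.
Qed.

(** * Lifting a nondegenerate solution along a deformation *)

Lemma bilD {S : comNzRingType} {n m} (B : 'I_n -> 'I_m -> S) r r' c c' :
  bil B (fun i => r i + r' i) (fun j => c j + c' j) =
  bil B r c + (bil B r' c + bil B r c') + bil B r' c'.
Proof.
rewrite /bil -!big_split; apply: eq_bigr => i _ /=.
by rewrite -!big_split; apply: eq_bigr => j _ /=; ring.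
Qed.

Lemma bilZl {S : comNzRingType} {n m} (B : 'I_n -> 'I_m -> S) a r c :
  bil B (fun i => a * r i) c = a * bil B r c.
Proof.
rewrite /bil mulr_sumr; apply: eq_bigr => i _.
by rewrite mulr_sumr; apply: eq_bigr => j _; ring.
Qed.

Lemma bilZr {S : comNzRingType} {n m} (B : 'I_n -> 'I_m -> S) a r c :
  bil B r (fun j => a * c j) = a * bil B r c.
Proof.
rewrite /bil mulr_sumr; apply: eq_bigr => i _.
by rewrite mulr_sumr; apply: eq_bigr => j _; ring.
Qed.

Lemma rmorph_bil {S S' : comNzRingType} (f : {rmorphism S -> S'}) {n m}
    (B : 'I_n -> 'I_m -> S) r c :
  f (bil B r c) = bil (fun i j => f (B i j)) (fun i => f (r i)) (fun j => f (c j)).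
Proof.
rewrite /bil rmorph_sum; apply: eq_bigr => i _.
by rewrite rmorph_sum; apply: eq_bigr => j _; rewrite !rmorphM.
Qed.

Lemma eq_bil {S : comNzRingType} {n m} (B B' : 'I_n -> 'I_m -> S) r r' c c' :
  B =2 B' -> r =1 r' -> c =1 c' -> bil B r c = bil B' r' c'.
Proof.
move=> eB er ec; apply: eq_bigr => i _; apply: eq_bigr => j _.
by rewrite eB er ec.
Qed.

Definition pencil {F : fieldType} {n m} (B B' : 'I_n -> 'I_m -> F) i j :
  {poly F} := (B i j)%:P + 'X * (B' i j)%:P.

(** Newton iteration: a correction of the solution by a multiple of 'X^(l+1)
    changes the equations at that order by the differential at (r0, c0), which is
    onto. *)
Lemma lift_solution (F : fieldType) (n m : nat) (I : Type)
    (B B' : I -> 'I_n -> 'I_m -> F) (b : I -> F) r0 c0 :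
  (forall k, bil (B k) r0 c0 = b k) ->
  (forall w : I -> F, exists r c, forall k,
     bil (B k) r c0 + bil (B k) r0 c = w k) ->
  forall l, exists (r : 'I_n -> {poly F}) (c : 'I_m -> {poly F}),
    [/\ forall i, (r i).[0] = r0 i, forall j, (c j).[0] = c0 j &
        forall k, exists h, bil (pencil (B k) (B' k)) r c
                              = (b k)%:P + 'X ^+ l.+1 * h].
Proof.
move=> sol0 jac.
have at0 k r c : (bil (pencil (B k) (B' k)) r c).[0] =
    bil (B k) (fun i => (r i).[0]) (fun j => (c j).[0]).
  rewrite -[LHS]/(horner_eval 0 _) rmorph_bil; apply: eq_bil => // i j.
  by rewrite /= /horner_eval /pencil !hornerE.
elim=> [|l [r [c [r_0 c_0 rcE]]]].
  exists (fun i => (r0 i)%:P), (fun j => (c0 j)%:P).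
  split=> [i|j|k]; rewrite ?hornerC //.
  set p := bil _ _ _.
  have /factor_theorem[h hE] : root (p - (b k)%:P) 0.
    apply/rootP; rewrite hornerD hornerN at0 hornerC -sol0.
    by apply/eqP; rewrite subr_eq0; apply/eqP/eq_bil => // i; rewrite hornerC.
  exists h; apply/eqP; rewrite addrC -subr_eq; apply/eqP.
  by rewrite hE subr0 expr1 mulrC.
have /choice[h hE] := rcE.
have [dr [dc dE]] := jac (fun k => - (h k).[0]).
exists (fun i => r i + 'X ^+ l.+1 * (dr i)%:P),
       (fun j => c j + 'X ^+ l.+1 * (dc j)%:P).
split=> [i|j|k].
- by rewrite !hornerE /= expr0n /= r_0 mul0r addr0.
- by rewrite !hornerE /= expr0n /= c_0 mul0r addr0.
set P := pencil _ _.
pose e := h k + (bil P (fun i => (dr i)%:P) c + bil P r (fun j => (dc j)%:P))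
  + 'X ^+ l.+1 * bil P (fun i => (dr i)%:P) (fun j => (dc j)%:P).
have /factor_theorem[g gE] : root e 0.
  apply/rootP; rewrite /e !hornerE !at0 /= expr0n /= mul0r addr0.
  apply: etrans (addrN (h k).[0]); rewrite -(dE k).
  by rewrite addrA; congr (_ + _ + _); apply: eq_bil => // i; rewrite ?hornerC.
exists g; rewrite bilD !bilZl !bilZr hE.
move: gE; rewrite subr0 => gE.
by rewrite [in RHS]exprS mulrAC -[in RHS](mulrC g) -gE /e; ring.
Qed.

(** D is a polynomial in an outer variable with coefficients in {poly F}. Along
    the lift y its lowest nonzero coefficient in the inner variable is the only
    contribution at its order. *)
Lemma lowest_coef_root (F : fieldType) (D : {poly {poly F}}) (a : F)
    (K : {pred F}) :
  0 \in K -> (forall i k, (D`_i)`_k \in K) -> D != 0 ->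
  (forall l, exists2 y : {poly F}, y.[0] = a & 'X ^+ l %| D.[y]) ->
  exists q : {poly F}, [/\ q != 0, q \is a polyOver K,
    (size q <= size D)%N & root q a].
Proof.
move=> K0 DK D0 Dy.
have exk : exists k, [exists i : 'I_(size D), (D`_i)`_k != 0].
  have lD : lead_coef D != 0 by rewrite lead_coef_eq0.
  exists (size (lead_coef D)).-1.
  have ltD : ((size D).-1 < size D)%N by rewrite prednK // size_poly_gt0.
  by apply/existsP; exists (Ordinal ltD); rewrite /= -!lead_coefE lead_coef_eq0.
case: (ex_minnP exk) => k /existsP[i0 nz] kmin.
exists (\poly_(i < size D) (D`_i)`_k); split.
- apply: contraNneq nz => /(congr1 (fun p : {poly F} => p`_i0)).
  by rewrite coef_poly ltn_ord coef0 => ->.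
- rewrite qualifE; apply/(all_nthP 0) => i _; rewrite coef_poly; case: ifP => // _; exact: DK.
- exact: size_poly.
apply/rootP; rewrite horner_poly.
have [y <- /dvdpP[h /(congr1 (fun p : {poly F} => p`_k))]] := Dy k.+1.
rewrite coefMXn ltnSn horner_coef coef_sum => Dk.
apply: etrans Dk; apply: eq_bigr => i _.
rewrite coefM big_ord_recr /= subnn big1 ?add0r => [|b _].
  by rewrite -horner_coef0 horner_exp.
case: (eqVneq (D`_i)`_b 0) => [->|nzb]; first by rewrite mul0r.
have /kmin : [exists i : 'I_(size D), (D`_i)`_b != 0].
  by apply/existsP; exists i.
by rewrite leqNgt ltn_ord.
Qed.

(** * Degree of a nondegenerate point of a linear section of a Segre variety *)

Section SegreSection.
Variables (F : fieldType) (K : divringClosed F) (n d : nat) (I : finType).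
Variables (x : I -> F) (o : I).
Hypotheses (x_inj : injective x) (xK : forall k, x k \in K).
Hypothesis cardI : (n.+1 + d <= #|I|)%N.

Variables (B : I -> 'I_n.+1 -> 'I_d.+1 -> F) (C : 'I_n.+1 -> 'I_d.+1 -> F).
Hypotheses (BK : forall k i j, B k i j \in K) (CK : forall i j, C i j \in K).

(* The product of the linear forms r(x_k) and c(x_k). *)
Let generic k (i : 'I_n.+1) (j : 'I_d.+1) := x k ^+ i * x k ^+ j.
Let dir k i j := generic k i j - B k i j.

(* The inner variable moves B k to [generic k]; the outer one is the value of
   the ratio B o / C. *)
Let family k i j : {poly {poly F}} :=
  (pencil (B k) (dir k) i j)%:P - ('X * (C i j)%:P%:P) *+ (k == o).

(** D is a maximal minor of the Sylvester matrix of the family which does not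
    vanish at the point (1, 0), where the family is [generic]. Cramer's rule
    turns a solution of the family modulo e into a zero of D modulo e, up to a
    factor r_i^(d+1) * c_j. *)
Lemma family_minor : exists D : {poly {poly F}},
  [/\ D != 0, (size D <= 'C(d + n, d).+1)%N,
      forall i l, (D`_i)`_l \in K &
      forall (y : {poly F}) e (r : 'I_n.+1 -> {poly F}) (c : 'I_d.+1 -> {poly F}),
        (forall k, exists h, bil (fun i j => (family k i j).[y]) r c = e * h) ->
        forall i j, exists h, D.[y] * (r i ^+ d.+1 * c j) = e * h].
Proof.
have full := sylvester_full F n.+1 d I x x_inj cardI.
pose f := fullrankfun full.
pose W := rowsub f (sylvester d family).
have mapW (S : comNzRingType) (g : {rmorphism {poly {poly F}} -> S}) :
    map_mx g W = rowsub f (sylvester d (fun k i j => g (family k i j))).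
  by rewrite -map_sylvester; apply/matrixP => u v; rewrite !mxE.
exists (\det W); split.
- have [g gE] : exists g : {rmorphism {poly {poly F}} -> F},
      forall k i j, g (family k i j) = generic k i j.
    exists (horner_eval 1 \o horner_eval 0) => k i j.
    rewrite /= /horner_eval /family /pencil /dir hornerD hornerN hornerMn.
    rewrite hornerM hornerX !mul0r mul0rn subr0 !hornerC.
    by rewrite hornerD hornerM hornerX !hornerC mul1r addrC subrK.
  apply: contraTneq (fullrowsub_unit full) => D0.
  rewrite unitmxE unitfE negbK -/f.
  rewrite (_ : rowsub f _ = map_mx g W) ?det_map_mx ?D0 ?rmorph0 // mapW.
  by congr (rowsub _ (sylvester _ _)); apply/funext => k; apply/funext => i;
     apply/funext => j; rewrite gE.
(* Only the rows built from the form o contain the outer variable, linearly,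
   and they differ by their monomials. *)
- pose last u : bool := (enum_val (f u) : mono n.+1 d * I).2 == o.
  have szW u v : (size (W u v) <= (last u : nat).+1)%N.
    rewrite !mxE; apply: (leq_trans (size_sum _ _ _)); apply/bigmax_leqP => i _.
    rewrite /family /last; case: eqP => _ /=.
      apply: (leq_trans (size_polyD _ _)); rewrite geq_max size_polyN mulr1n.
      rewrite (leq_trans (size_polyC_leq1 _)) //=.
      apply: (leq_trans (size_polyMleq _ _)); rewrite size_polyX.
      by rewrite addSn /= ltnS size_polyC_leq1.
    by rewrite mulr0n subr0 size_polyC_leq1.
  apply: (leq_trans (size_det_rows _ _ _ _ szW)); rewrite ltnS -card_mono.
  rewrite (eq_bigr (fun u => if last u then 1 else 0)%N) => [|u _]; last first.
    by case: (last u).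
  rewrite -big_mkcond sum1_card.
  apply: (leq_card_in (fun u => (enum_val (f u) : mono n.+1 d * I).1)).
  move=> u v; rewrite !unfold_in /last => /eqP uo /eqP vo uv.
  apply: (@fullrankfun_inj _ _ _ _ full); apply: enum_val_inj.
  by rewrite [LHS]surjective_pairing [RHS]surjective_pairing uo vo uv.
- have DK : \det W \is a polyOver (polyOver_pred K).
    apply: rpred_sum => s _; rewrite rpredMsign; apply: rpred_prod => u _.
    rewrite !mxE; apply: rpred_sum => a _.
    have xXK k m : x k ^+ m \in K by exact: rpredX.
    rewrite /family /pencil /dir rpredB //.
      by rewrite polyOverC rpredD ?rpredM ?polyOverX ?polyOverC ?rpredB ?rpredM.
    by rewrite rpredMn // rpredM ?polyOverX // !polyOverC.
  by move=> i l; move/polyOverP: DK => /(_ i)/polyOverP.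
- move=> y e r c /choice[h hE] i j.
  pose M := map_mx (horner_eval y) W.
  have ME : M = rowsub f (sylvester d (fun k i j => (family k i j).[y])).
    exact: mapW.
  pose v := monomials d.+1 r c.
  have Mv u : (M *m v) u 0 = e *
      let bk : mono n.+1 d * I := enum_val (f u) in
      \prod_(i <- bk.1) r i * h bk.2.
    by rewrite ME mul_rowsub_mx mxE sylvester_monomials /= hE; ring.
  have [|a ha] := @sorted_mono_unique n.+1 d.+1 (nseq d.+1 i); first by rewrite size_nseq.
  pose w : 'I_#|{: mono n.+1 d.+1 * 'I_d.+1}| := enum_rank (a, j).
  have vw : v w 0 = r i ^+ d.+1 * c j.
    rewrite mxE enum_rankK /= (perm_big (nseq d.+1 i)); last by rewrite perm_sym ha.
    by rewrite big_nseq iter_mulr_1.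
  rewrite -vw.
  have -> : (\det W).[y] * v w 0 = ((\adj M *m M) *m v) w 0.
    by rewrite mul_adj_mx mul_scalar_mx /M det_map_mx [RHS]mxE.
  rewrite -mulmxA mxE; under eq_bigr => u _ do rewrite Mv mulrCA.
  by rewrite -mulr_sumr; eexists.
Qed.

(** The degree of P^n x P^d in its Segre embedding bounds the degree of the
    value lam of B o / C at an isolated zero of the other forms. Normalizing
    C to the constant tau turns the projective solution into an affine one, whose
    differential is required to be onto. *)
Theorem isolated_point_degree r0 c0 lam tau :
  tau != 0 ->
  (forall k, k != o -> bil (B k) r0 c0 = 0) ->
  bil (B o) r0 c0 = lam * tau -> bil C r0 c0 = tau ->
  (forall w : I -> F, exists r c, forall k,
     let G := if k == o then C else B k in bil G r c0 + bil G r0 c = w k) ->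
  exists q : {poly F}, [/\ q != 0, q \is a polyOver K,
    (size q <= 'C(d + n, d).+1)%N & root q lam].
Proof.
move=> tau0 solB solo solC jac.
have [D [D0 szD DK Dy]] := family_minor.
have [i0 [j0 nz0]] : exists i j, r0 i * c0 j != 0.
  apply: contrapT => nex; case/negP: tau0; rewrite -solC; apply/eqP.
  apply: big1 => i _; apply: big1 => j _; rewrite -mulrA.
  case: (eqVneq (r0 i * c0 j) 0) => [->|nz]; first by rewrite mulr0.
  by case: nex; exists i, j.
have [|q [q0 qK szq rq]] := @lowest_coef_root F D lam K (rpred0 _) DK D0; last first.
  by exists q; split=> //; apply: leq_trans szD.
move=> l.
pose G k := if k == o then C else B k.
pose G' k := if k == o then (fun _ _ => 0) else dir k.
have solG k : bil (G k) r0 c0 = if k == o then tau else 0.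
  by rewrite /G; case: eqVneq => // /solB.
have [r [c [r_0 c_0 rcE]]] := lift_solution F _ _ I G G' _ r0 c0 solG jac l.
(* C equals tau up to 'X^(l+1) along the lift, so y represents B o / C. *)
pose y := bil (pencil (B o) (dir o)) r c * (tau^-1)%:P.
exists y.
  rewrite hornerM hornerC -[X in X / _]/(horner_eval 0 _) rmorph_bil.
  apply: (canLR (mulfK tau0)); rewrite -solo; apply: eq_bil => // i j.
  by rewrite /= /horner_eval /pencil !hornerE.
have famE k : exists h, bil (fun i j => (family k i j).[y]) r c = 'X ^+ l.+1 * h.
  have -> : bil (fun i j => (family k i j).[y]) r c =
      bil (pencil (B k) (dir k)) r c
      - (y * bil (fun i j => (C i j)%:P) r c) *+ (k == o).
    rewrite /bil mulr_sumr -sumrMnl -sumrB; apply: eq_bigr => i _.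
    rewrite mulr_sumr -sumrMnl -sumrB; apply: eq_bigr => j _.
    rewrite /family hornerD hornerN hornerMn hornerM hornerX !hornerC.
    by case: (k == o); rewrite ?mulr1n ?mulr0n; ring.
  have [h] := rcE k; rewrite /G /G'; case: eqVneq => [->|_] hE; last first.
    by exists h; rewrite hE mulr0n subr0 add0r.
  exists (- (y * h)); rewrite mulr1n.
  have -> : bil (fun i j => (C i j)%:P) r c = tau%:P + 'X ^+ l.+1 * h.
    by rewrite -hE; apply: eq_bil => // i j; rewrite /pencil mulr0 addr0.
  have -> : bil (pencil (B o) (dir o)) r c = y * tau%:P.
    by rewrite /y -mulrA -polyCM mulVf // mulr1.
  by ring.
have [h hE] := Dy y _ r c famE i0 j0.
apply: (dvdp_trans (dvdp_exp2l 'X (leqnSn l))).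
rewrite -(@Gauss_dvdpl _ _ (r i0 ^+ d.+1 * c j0)); first by rewrite hE dvdp_mulr.
apply: coprimep_expl; rewrite coprimep_sym coprimepX.
rewrite rootE hornerM horner_exp r_0 c_0 mulf_eq0 expf_eq0 /=.
by move: nz0; rewrite mulf_eq0.
Qed.

End SegreSection.

(** * Nondegeneracy of the Sinkhorn equations *)

Lemma sum_mulrb_eq (V : nmodType) (I : finType) (f : I -> V) i :
  \sum_a f a *+ (a == i) = f i.
Proof.
rewrite (bigD1 i) //= eqxx big1 ?addr0 // => a /negPf ->; exact: mulr0n.
Qed.

(** The map from (x, y) to the row and column sums of s_ij (x_i + y_j) is symmetric,
    positive semidefinite, with kernel spanned by (1, -1). Adding x_0^2 to the
    energy makes it invertible; comparing totals shows that x_0 = 0 in the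
    solution found, so that the added term has no effect. *)
Lemma sum_laplacian_surj (R : realFieldType) (n m : nat)
    (s : 'I_n.+1 -> 'I_m.+1 -> R) (rho : 'I_n.+1 -> R) (gam : 'I_m.+1 -> R) :
  (forall i j, 0 < s i j) -> \sum_i rho i = \sum_j gam j ->
  exists x y, (forall i, \sum_j s i j * (x i + y j) = rho i) /\
              (forall j, \sum_i s i j * (x i + y j) = gam j).
Proof.
move=> s_gt0 rho_gam.
pose G : 'M[R]_(n.+1 + m.+1) :=
  block_mx (diag_mx (\row_i (\sum_j s i j + (i == 0)%:R))) (\matrix_(i, j) s i j)
           (\matrix_(j, i) s i j) (diag_mx (\row_j \sum_i s i j)).
pose xx (z : 'rV[R]_(n.+1 + m.+1)) i := z 0 (lshift m.+1 i).
pose yy (z : 'rV[R]_(n.+1 + m.+1)) j := z 0 (rshift n.+1 j).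
have Gl z i : (z *m G) 0 (lshift _ i) =
    \sum_j s i j * (xx z i + yy z j) + xx z 0 *+ (i == 0).
  rewrite mxE big_split_ord /=.
  under eq_bigr => a _ do rewrite block_mxEul !mxE mulrnAr.
  under [X in _ + X]eq_bigr => b _ do rewrite block_mxEdl mxE mulrC.
  rewrite sum_mulrb_eq mulrDr mulr_sumr addrAC -big_split; congr (_ + _).
    by apply: eq_bigr => j _; rewrite /xx /yy /=; ring.
  by case: eqP => [->|_]; rewrite ?mulr1 ?mulr0.
have Gr z j : (z *m G) 0 (rshift _ j) = \sum_i s i j * (xx z i + yy z j).
  rewrite mxE big_split_ord /=.
  under eq_bigr => a _ do rewrite block_mxEur mxE mulrC.
  under [X in _ + X]eq_bigr => b _ do rewrite block_mxEdr !mxE mulrnAr.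
  rewrite sum_mulrb_eq mulr_sumr -big_split.
  by apply: eq_bigr => i _; rewrite /xx /yy /=; ring.
have Gu : G \in unitmx.
  rewrite -row_free_unit; apply: inj_row_free => z zG0.
  have el i : \sum_j s i j * (xx z i + yy z j) + xx z 0 *+ (i == 0) = 0.
    by rewrite -Gl zG0 mxE.
  have er j : \sum_i s i j * (xx z i + yy z j) = 0 by rewrite -Gr zG0 mxE.
  have energy : \sum_i \sum_j s i j * (xx z i + yy z j) ^+ 2 + xx z 0 ^+ 2 = 0.
    transitivity (\sum_i xx z i * (\sum_j s i j * (xx z i + yy z j)
                                   + xx z 0 *+ (i == 0))
      + \sum_j yy z j * \sum_i s i j * (xx z i + yy z j)).
      under [X in _ = X + _]eq_bigr => i _ do rewrite mulrDr mulr_sumr mulrnAr.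
      rewrite big_split /= sum_mulrb_eq -expr2 addrAC; congr (_ + _).
      under [X in _ = _ + X]eq_bigr => j _ do rewrite mulr_sumr.
      rewrite [X in _ = _ + X]exchange_big -big_split; apply: eq_bigr => i _.
      by rewrite -big_split; apply: eq_bigr => j _ /=; ring.
    by rewrite !big1 ?addr0 // => i _; rewrite ?el ?er mulr0.
  have sq_ge0 i j : 0 <= s i j * (xx z i + yy z j) ^+ 2.
    by rewrite mulr_ge0 ?sqr_ge0 // ltW.
  move/eqP: energy; rewrite paddr_eq0 ?sqr_ge0 //; last first.
    by apply: sumr_ge0 => i _; apply: sumr_ge0.
  rewrite psumr_eq0 => [/andP[/allP e0 x0]|i _]; last exact: sumr_ge0.
  have {x0}x0 : xx z 0 = 0 by apply/eqP; rewrite -sqrf_eq0.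
  have xy i j : xx z i + yy z j = 0.
    have := e0 i (mem_index_enum _); rewrite psumr_eq0 // => /allP/(_ j).
    rewrite mem_index_enum => /(_ isT)/=.
    by rewrite mulf_eq0 gt_eqF //= sqrf_eq0 => /eqP.
  have y0 j : yy z j = 0 by have := xy 0 j; rewrite x0 add0r.
  apply/rowP => k; rewrite mxE -(splitK k); case: (split k) => [i|j] /=.
    by have := xy i 0; rewrite y0 addr0.
  exact: y0.
pose w : 'rV[R]_(n.+1 + m.+1) := row_mx (\row_i rho i) (\row_j gam j).
pose z := w *m invmx G.
have zG : z *m G = w by rewrite mulmxKV.
have el i : \sum_j s i j * (xx z i + yy z j) + xx z 0 *+ (i == 0) = rho i.
  by rewrite -Gl zG row_mxEl mxE.
have er j : \sum_i s i j * (xx z i + yy z j) = gam j.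
  by rewrite -Gr zG row_mxEr mxE.
have x0 : xx z 0 = 0.
  move: rho_gam; under eq_bigr => i _ do rewrite -el.
  under [RHS]eq_bigr => j _ do rewrite -er.
  rewrite big_split /= [X in _ = X]exchange_big /= => /eqP.
  by rewrite -subr_eq0 addrAC subrr add0r sum_mulrb_eq => /eqP.
exists (xx z), (yy z); split=> [i|//].
by rewrite -el x0 mul0rn addr0.
Qed.

(** * Degrees over the field of entries *)

Lemma algebraic_degree_le (F : fieldType) (K : divringClosed F) (x : F)
    (q : {poly F}) (N : nat) :
  q != 0 -> q \is a polyOver K -> (size q <= N.+1)%N -> root q x ->
  exists2 d, algebraic_of_degree K x d & (d <= N)%N.
Proof.
move=> q0 qK szq rq.
pose P k := `[< exists p : {poly F},
  [/\ p != 0, p \is a polyOver K, root p x & size p = k] >].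
have exP : exists k, P k by exists (size q); apply/asboolP; exists q.
case: (ex_minnP exP) => k /asboolP[p [p0 pK rp <-]] kmin.
have min p' : p' != 0 -> p' \is a polyOver K -> root p' x -> (size p <= size p')%N.
  by move=> *; apply: kmin; apply/asboolP; exists p'.
have lp : lead_coef p != 0 by rewrite lead_coef_eq0.
have lpK : lead_coef p \in K by move/polyOverP: pK; apply.
have sz : (size p > 0)%N by rewrite size_poly_gt0.
exists (size p).-1; last first.
  by rewrite -ltnS prednK //; apply: leq_trans szq; apply: min.
exists ((lead_coef p)^-1 *: p); last by rewrite size_scale ?invr_eq0 // prednK.
split.
- by rewrite monicE lead_coefZ mulVf.
- by rewrite polyOverZ // rpredV.
- by rewrite rootZ ?invr_eq0.
- by move=> p' p'K p'0 rp'; rewrite size_scale ?invr_eq0 // min.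
Qed.

HB.instance Definition _ (F : fieldType) (X : set F) :=
  GRing.isDivringClosed.Build F (gen_subfield X) (gen_subfield_closed X).

(** The differential of a bilinear form in logarithmic coordinates. *)
Lemma bil_log {F : fieldType} {n m} (G : 'I_n -> 'I_m -> F) r c x y :
  bil G (fun i => r i * x i) c + bil G r (fun j => c j * y j) =
  \sum_i \sum_j G i j * r i * c j * (x i + y j).
Proof.
rewrite /bil -big_split; apply: eq_bigr => i _ /=.
by rewrite -big_split; apply: eq_bigr => j _ /=; ring.
Qed.

(** * The degree bound for Sinkhorn limits *)

Theorem theorem3p1p1 (R : realType) (n m : nat) (hn : (0 < n)%N) (hm : (0 < m)%N)
  (A : 'M[R]_(n, m)) (Rv : 'cV[R]_n) (Cv : 'cV[R]_m) (S : 'M[R]_(n, m))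
  (hA : forall i j, 0 < A i j)
  (hR : forall i, 0 < Rv i 0)
  (hC : forall j, 0 < Cv j 0)
  (hRC : \sum_i Rv i 0 = \sum_j Cv j 0)
  (hS : is_sinkhorn_limit A Rv Cv S) :
  forall (i : 'I_n) (j : 'I_m),
    exists2 d : nat, algebraic_of_degree (entries_field A Rv Cv) (S i j) d
      & (d <= 'C(n + m - 2, n - 1))%N.
Proof.
case: n hn A Rv S hA hR hRC hS => // n _; case: m hm Cv hC => // m _.
move=> Cv hC A Rv S hA hR hRC [r [c [[r_gt0 c_gt0] SE S_row S_col]]] i1 j1.
pose X := (range (fun ij : 'I_n.+1 * 'I_m.+1 => A ij.1 ij.2)
             `|` range (fun i => Rv i 0) `|` range (fun j => Cv j 0))%classic.
pose K : divringClosed R := gen_subfield X.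
have AK i j : A i j \in K by apply: sub_gen_subfield; left; left; exists (i, j).
have RK i : Rv i 0 \in K by apply: sub_gen_subfield; left; right; exists i.
have CK j : Cv j 0 \in K by apply: sub_gen_subfield; right; exists j.
pose tau := \sum_i Rv i 0.
have tau_gt0 : 0 < tau.
  rewrite /tau big_ord_recl ltr_pwDl //; apply: sumr_ge0 => i _; exact: ltW.
have tauK : tau \in K by apply: rpred_sum.
have Sij i j : S i j = A i j * r 0 i * c 0 j.
  by rewrite SE mul_diag_mx mul_mx_diag !mxE mulrAC mulrC; ring.
have S_gt0 i j : 0 < S i j by rewrite Sij !mulr_gt0.
have rowS i : \sum_j S i j = Rv i 0.
  by rewrite -S_row mxE; apply: eq_bigr => j _; rewrite mxE mulr1.
have colS j : \sum_i S i j = Cv j 0.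
  by rewrite -S_col mxE; apply: eq_bigr => i _; rewrite !mxE mulr1.
(* The row and column of index 0 are left out: their equations follow from the
   others. *)
pose b (k : option ('I_n + 'I_m)) i j : R :=
  match k with
  | Some (inl a) => tau *+ (i == lift ord0 a) - Rv (lift ord0 a) 0
  | Some (inr a) => tau *+ (j == lift ord0 a) - Cv (lift ord0 a) 0
  | None => tau *+ ((i == i1) && (j == j1))
  end.
pose B k i j := b k i j * A i j.
have BK k i j : B k i j \in K.
  by case: k => [[a|a]|] /=; rewrite /B /b rpredM ?rpredB ?rpredMn.
pose xx (k : option ('I_n + 'I_m)) : R := (enum_rank k)%:R.
(* Used both for t = S and for t an infinitesimal variation of S. *)
have Brow a (t : 'I_n.+1 -> 'I_m.+1 -> R) :
    \sum_i \sum_j b (Some (inl a)) i j * t i j =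
    tau * \sum_j t (lift ord0 a) j - Rv (lift ord0 a) 0 * \sum_i \sum_j t i j.
  rewrite [X in _ = _ - X]mulr_sumr -(sum_mulrb_eq _ _ (fun i => tau * \sum_j t i j)).
  rewrite -sumrB; apply: eq_bigr => i _; rewrite !mulr_sumr -sumrMnl -sumrB.
  by apply: eq_bigr => j _; rewrite mulrBl mulrnAl.
have Bcol a (t : 'I_n.+1 -> 'I_m.+1 -> R) :
    \sum_i \sum_j b (Some (inr a)) i j * t i j =
    tau * \sum_i t i (lift ord0 a) - Cv (lift ord0 a) 0 * \sum_i \sum_j t i j.
  rewrite !mulr_sumr -sumrB; apply: eq_bigr => i _.
  rewrite mulr_sumr -(sum_mulrb_eq _ _ (fun j => tau * t i j)) -sumrB.
  by apply: eq_bigr => j _; rewrite mulrBl mulrnAl.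
have sumS : \sum_i \sum_j S i j = tau by apply: eq_bigr.
have [||||k|||w|q [q0 qK szq rq]] := @isolated_point_degree R K n m
    (option ('I_n + 'I_m)) xx None _ _ _ B (fun i j => A i j) BK AK
    (fun i => r 0 i) (fun j => c 0 j) (S i1 j1) tau.
- by move=> k l /eqP; rewrite eqr_nat => /eqP/val_inj/enum_rank_inj.
- by move=> k; apply: rpred_nat.
- by rewrite card_option card_sum !card_ord addSn.
- by rewrite gt_eqF.
- have bilB : bil (B k) (fun i => r 0 i) (fun j => c 0 j) =
      \sum_i \sum_j b k i j * S i j.
    apply: eq_bigr => i _; apply: eq_bigr => j _.
    by rewrite Sij /B !mulrA.
  case: k bilB => [[a|a]|] // -> _; rewrite (Brow, Bcol) sumS ?rowS ?colS; ring.
- rewrite /bil (bigD1 i1) //= [X in _ + X]big1 ?addr0 => [|i /negPf ii1]; last first.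
    by apply: big1 => j _; rewrite /B /b ii1 mulr0n !mul0r.
  rewrite (bigD1 j1) //= big1 ?addr0 => [|j /negPf jj1]; last first.
    by rewrite /B /b jj1 andbF mulr0n !mul0r.
  by rewrite /B /b !eqxx mulr1n Sij; ring.
- rewrite -sumS; apply: eq_bigr => i _; apply: eq_bigr => j _.
  by rewrite Sij.
(* The prescribed variations of the equations and of the total determine those
   of all row sums and column sums. *)
- pose u a := (w (Some (inl a)) + Rv (lift ord0 a) 0 * w None) / tau.
  pose v a := (w (Some (inr a)) + Cv (lift ord0 a) 0 * w None) / tau.
  pose rho i := if unlift ord0 i is Some a then u a else w None - \sum_a u a.
  pose gam j := if unlift ord0 j is Some a then v a else w None - \sum_a v a.
  have rhoE : \sum_i rho i = w None.
    rewrite big_ord_recl /rho unlift_none [X in _ + X](eq_bigr u) ?subrK // => a _.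
    by rewrite liftK.
  have gamE : \sum_j gam j = w None.
    rewrite big_ord_recl /gam unlift_none [X in _ + X](eq_bigr v) ?subrK // => a _.
    by rewrite liftK.
  have [x [y [xE yE]]] := sum_laplacian_surj _ _ _ S rho gam S_gt0
    (etrans rhoE (esym gamE)).
  have totE : \sum_i \sum_j S i j * (x i + y j) = w None.
    by rewrite -rhoE; apply: eq_bigr.
  exists (fun i => r 0 i * x i), (fun j => c 0 j * y j) => k /=.
  rewrite bil_log; case: k => [[a|a]|] /=.
  + transitivity (\sum_i \sum_j b (Some (inl a)) i j * (S i j * (x i + y j))).
      by apply: eq_bigr => i _; apply: eq_bigr => j _; rewrite Sij /B; ring.
    by rewrite Brow xE totE /rho liftK /u mulrC divfK ?gt_eqF // addrK.
  + transitivity (\sum_i \sum_j b (Some (inr a)) i j * (S i j * (x i + y j))).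
      by apply: eq_bigr => i _; apply: eq_bigr => j _; rewrite Sij /B; ring.
    by rewrite Bcol yE totE /gam liftK /v mulrC divfK ?gt_eqF // addrK.
  + rewrite -totE; apply: eq_bigr => i _; apply: eq_bigr => j _.
    by rewrite Sij.
- have -> : (n.+1 + m.+1 - 2 = m + n)%N by rewrite addSn addnS subn2 addnC.
  rewrite subn1 /= -[n in 'C(_, n)](addKn m n) bin_sub ?leq_addr //.
  exact: (algebraic_degree_le _ K _ _ _ q0 qK szq rq).
Qed.
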